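(* Let $\mathcal{H}$ be a Hilbert space, let $W=(W(h))_{h\in\mathcal{H}}$ be an isonormal Gaussian process on $\mathcal{H}$, and let $\mathcal{F}\subset\mathcal{H}$. Then for all $\delta\geq 0$, \[ \omega(\mathrm{conv}(\mathcal{F}),\delta)\leq \inf_{\varepsilon>0}\left(2\,\omega(\mathcal{F},\varepsilon)+\delta\sqrt{N(\mathcal{F},\varepsilon)}\right), \] where $\mathrm{conv}(\mathcal{F})$ denotes the convex hull of $\mathcal{F}$.
   Context: An isonormal Gaussian process on $\mathcal{H}$ is a family $(W(h))_{h\in\mathcal{H}}$ of centered jointly Gaussian random variables with $\mathbb{E}[W(h)W(h')]=\langle h,h'\rangle_{\mathcal{H}}$ for all $h,h'\in\mathcal{H}$. For $A\subset\mathcal{H}$ and $\delta\geq0$, the modulus of continuity is $\omega(A,\delta)=\mathbb{E}\Big[\sup_{f,g\in A,\ \|f-g\|\leq\delta}|W(f)-W(g)|\Big]$. For $\varepsilon>0$, $N(A,\varepsilon)$ is the $\varepsilon$-covering number of $A$: the minimal cardinality of a subset $A_\varepsilon\subset A$ such that $A$ is contained in the union of the closed balls of radius $\varepsilon$ centered at points of $A_\varepsilon$. *)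

(* Defs.v *)
From HB Require Import structures.
From mathcomp Require Import all_boot all_order all_algebra.
From mathcomp Require Import all_classical all_reals all_analysis.
From mathcomp Require Import finmap.
Set Implicit Arguments.
Unset Strict Implicit.
Unset Printing Implicit Defensive.
Import Order.TTheory GRing.Theory Num.Theory.
Import numFieldNormedType.Exports.
Local Open Scope classical_set_scope.
Local Open Scope ring_scope.

Section defs.
Context {R : realType}.

(* ip is an inner product on the normed space H inducing its norm.
   A Hilbert space is then a completeNormedModType R equipped with such ip. *)
Definition inner_product {H : normedModType R} (ip : H -> H -> R) : Prop :=
  (forall x y, ip x y = ip y x) /\
  (forall (a : R) (x y z : H), ip (a *: x + y) z = a * ip x z + ip y z) /\
  (forall x, ip x x = `|x| ^+ 2).

Definition centered_gaussian {d} {Omega : measurableType d}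
  (P : probability Omega R) (X : Omega -> R) (v : R) : Prop :=
  measurable_fun setT X /\
  if v == 0 then P [set w | X w = 0] = 1%E
  else forall B : set R, measurable B ->
         P (X @^-1` B) = normal_prob 0 (Num.sqrt v) B.

(* Isonormal Gaussian process: (W h)_h centered jointly Gaussian with
   covariance ip, i.e. every finite linear combination
   sum_i a_i W(h_i) is N(0, sum_{i,j} a_i a_j <h_i,h_j>). *)
Definition isonormal {H : normedModType R} (ip : H -> H -> R)
  {d} {Omega : measurableType d} (P : probability Omega R)
  (W : H -> Omega -> R) : Prop :=
  forall (n : nat) (a : 'I_n -> R) (h : 'I_n -> H),
    centered_gaussian P (fun w => \sum_(i < n) a i * W (h i) w)
      (\sum_(i < n) \sum_(j < n) a i * a j * ip (h i) (h j)).

Definition pair_sup {H : normedModType R} {Omega : Type}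
  (W : H -> Omega -> R) (S : {fset H}) (delta : R) (w : Omega) : R :=
  \big[Num.max/0]_(f <- S) \big[Num.max/0]_(g <- S | `|f - g| <= delta)
     `|W f w - W g w|.

(* modulus of continuity omega(A, delta); the expectation of the
   (uncountable) supremum is understood as the supremum over finite
   subsets of A (lattice supremum convention). *)
Definition modulus {H : normedModType R} {d} {Omega : measurableType d}
  (P : probability Omega R) (W : H -> Omega -> R) (A : set H) (delta : R)
  : \bar R :=
  ereal_sup [set z | exists S : {fset H}, (forall x, x \in S -> A x) /\
     z = (\int[P]_w (pair_sup W S delta w)%:E)%E].

(* epsilon-covering number (+oo if no finite cover exists) *)
Definition covering_number {H : normedModType R} (A : set H) (eps : R)
  : \bar R :=
  ereal_inf [set z | exists S : {fset H}, (forall x, x \in S -> A x) /\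
     (forall x, A x -> exists2 y, y \in S & `|x - y| <= eps) /\
     z = (#|` S|%:R)%:E].

Definition sqrte (x : \bar R) : \bar R :=
  match x with
  | r%:E => (Num.sqrt r)%:E
  | +oo%E => +oo%E
  | -oo%E => 0%E
  end.

Definition conv_hull {H : normedModType R} (A : set H) : set H :=
  [set x | exists (n : nat) (a : 'I_n -> R) (f : 'I_n -> H),
     (forall i, 0 <= a i) /\ \sum_(i < n) a i = 1 /\
     (forall i, A (f i)) /\ x = \sum_(i < n) a i *: f i].

End defs.

(* Main.v *)
Require Import Defs.
From HB Require Import structures.
From mathcomp Require Import all_boot all_order all_algebra.
From mathcomp Require Import all_classical all_reals all_analysis.
From mathcomp Require Import finmap.
From mathcomp Require Import measurable_realfun lra ring.
Set Implicit Arguments.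
Unset Strict Implicit.
Unset Printing Implicit Defensive.
Import Order.TTheory GRing.Theory Num.Theory.
Import numFieldNormedType.Exports.
Local Open Scope classical_set_scope.
Local Open Scope ring_scope.

(* Let N be an eps-net of F, e an orthonormal basis of its span, and Pi the
   orthogonal projection onto that span.  For f, g in conv F write
   W f - W g = W (Pi (f - g)) + W (f - Pi f) - W (g - Pi g).  The first term is
   a Gaussian linear form in the at most #|N| variables W y, y in e, which gives
   delta * sqrt #|N|.  By convexity the other two are bounded by the supremum
   over u in F of |W (k - Pi k)|, with k = u - pi u and pi u in N at distance at
   most eps from u, because pi u - Pi (pi u) = 0.  Since k - Pi k is the midpoint
   of k and of its reflection k - 2 Pi k, and the reflection is an isometry, this
   supremum has expectation at most that of sup |W k|, hence at most the modulus
   of F at eps.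

   The invariance of E max_i |W (h i)| under isometries is deduced from the
   one-dimensional laws of linear combinations: these determine the expectation
   of every uniform limit of sums of cosines of linear forms, such functions are
   stable under products, absolute values and maxima, and
   k * |sin (x / k)| tends to |x| from below. *)

(** * Almost periodic functions of n real variables and their closure under products *)

Section almost_periodic.
Context {R : realType} {n : nat}.
Implicit Types (f g : ('I_n -> R) -> R) (x : 'I_n -> R).

(** An inductive closure of the cosines, so that statements on expectations can be proved by
    induction; the phase [b] provides the sines as well. The fixed rate in [ap_lim] loses no
    generality, by [ap_ulim]. *)
Inductive almost_periodic : (('I_n -> R) -> R) -> Prop :=
| ap_cos (a : 'I_n -> R) (b : R) :
    almost_periodic (fun x => cos (\sum_(i < n) a i * x i + b))
| ap_add f g : almost_periodic f -> almost_periodic g ->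
    almost_periodic (fun x => f x + g x)
| ap_scale (c : R) f : almost_periodic f -> almost_periodic (fun x => c * f x)
| ap_lim (f_ : nat -> ('I_n -> R) -> R) f :
    (forall k, almost_periodic (f_ k)) ->
    (forall k x, `|f x - f_ k x| <= k.+1%:R^-1) -> almost_periodic f.

Lemma ap_ext f g : f =1 g -> almost_periodic f -> almost_periodic g.
Proof. by move=> /funext ->. Qed.

Lemma ap_ulim f :
  (forall e : R, 0 < e ->
     exists2 g, almost_periodic g & forall x, `|f x - g x| <= e) ->
  almost_periodic f.
Proof.
move=> fP; have /choice[g gP] : forall k : nat, exists g,
    almost_periodic g /\ forall x, `|f x - g x| <= k.+1%:R^-1.
  by move=> k; have [|g ag fg] := fP k.+1%:R^-1; [rewrite invr_gt0|exists g].
by apply: (@ap_lim g) => k; [exact: (gP k).1|exact: (gP k).2].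
Qed.

Lemma ap_bounded f : almost_periodic f -> exists M : R, forall x, `|f x| <= M.
Proof.
elim=> {f} [a b|f g _ [M fM] _ [N gN]|c f _ [M fM]|f_ f _ IH ff].
- by exists 1 => x; exact: cos_max.
- by exists (M + N) => x; rewrite (le_trans (ler_normD _ _))// lerD.
- by exists (`|c| * M) => x; rewrite normrM ler_wpM2l.
- have [M fM] := IH 0%N; exists (1 + M) => x.
  rewrite -[f x](subrK (f_ 0%N x)) (le_trans (ler_normD _ _))// lerD//.
  by have := ff 0%N x; rewrite invr1.
Qed.

(** For two cosines this is the product-to-sum formula. Uniform limits keep their rate because |cos|
    <= 1. *)
Lemma ap_mul_cos (a : 'I_n -> R) (b : R) g : almost_periodic g ->
  almost_periodic (fun x => cos (\sum_(i < n) a i * x i + b) * g x).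
Proof.
elim=> {g} [a' b'|f g _ IHf _ IHg|c f _ IHf|f_ f _ IH ff].
- apply: (@ap_ext (fun x =>
     2^-1 * cos (\sum_(i < n) (a i + a' i) * x i + (b + b')) +
     2^-1 * cos (\sum_(i < n) (a i - a' i) * x i + (b - b')))); last first.
    by apply: ap_add; apply: ap_scale; exact: ap_cos.
  move=> x; set s := \sum_(i < n) a i * x i; set t := \sum_(i < n) a' i * x i.
  have -> : \sum_(i < n) (a i + a' i) * x i + (b + b') = (s + b) + (t + b').
    under eq_bigr do rewrite mulrDl.
    by rewrite big_split /= -/s -/t; ring.
  have -> : \sum_(i < n) (a i - a' i) * x i + (b - b') = (s + b) - (t + b').
    under eq_bigr do rewrite mulrBl.
    by rewrite big_split /= sumrN -/s -/t; ring.
  by rewrite cosD cosB; field.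
- by apply: ap_ext (ap_add IHf IHg) => x; rewrite mulrDr.
- by apply: ap_ext (ap_scale c IHf) => x; rewrite mulrCA.
- apply: (ap_lim IH) => k x; rewrite -mulrBr normrM.
  by rewrite (le_trans _ (ff k x))// ler_piMl// cos_max.
Qed.

Lemma ap_mul f g : almost_periodic f -> almost_periodic g ->
  almost_periodic (fun x => f x * g x).
Proof.
move=> af ag; elim: af => {f} [a b|f h _ IHf _ IHg|c f _ IHf|f_ f _ IH ff].
- exact: ap_mul_cos.
- by apply: ap_ext (ap_add IHf IHg) => x; rewrite mulrDl.
- by apply: ap_ext (ap_scale c IHf) => x; rewrite mulrA.
(* Multiplication by [g] may spoil the rate required by [ap_lim], hence the detour through
   [ap_ulim]; the bound is enlarged to |M| + 1 so that one can divide by it. *)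
- have [M gM] := ap_bounded ag.
  have M0 : 0 < `|M| + 1 by rewrite ltr_pwDr.
  apply: ap_ulim => e e0.
  have [k ke] : exists k : nat, k.+1%:R^-1 <= e / (`|M| + 1).
    have d0 : 0 < e / (`|M| + 1) by rewrite divr_gt0.
    exists (Num.trunc (e / (`|M| + 1))^-1).
    rewrite -[leRHS]invrK lef_pV2 ?posrE ?invr_gt0//.
    exact/ltW/truncnS_gt.
  exists (fun x => f_ k x * g x); first exact: IH.
  move=> x; rewrite -mulrBl normrM.
  rewrite (@le_trans _ _ (e / (`|M| + 1) * (`|M| + 1)))//; last first.
    by rewrite divfK// gt_eqF.
  rewrite ler_pM// ?(le_trans (ff k x))//.
  by rewrite (le_trans (gM x))// (le_trans (ler_norm _))// lerDl.
Qed.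

Lemma ap_cst (c : R) : almost_periodic (fun=> c).
Proof.
apply: ap_ext (ap_scale c (ap_cos (fun=> 0) 0)) => x.
by rewrite big1 ?addr0 ?cos0 ?mulr1// => i _; rewrite mul0r.
Qed.

Lemma ap_sin_coord (c : R) (i : 'I_n) :
  almost_periodic (fun x => sin (c * x i)).
Proof.
apply: ap_ext (ap_cos (fun j => if j == i then c else 0) (- (pi / 2))) => x.
rewrite cosBpihalf (bigD1 i)//= eqxx big1 ?addr0// => j /negbTE ->.
by rewrite mul0r.
Qed.

End almost_periodic.

(** * Uniform polynomial approximation of the absolute value *)

Section abs_approximation.
Context {R : realType}.

(* The increasing iteration for the square root of [u ^ 2], which converges
   uniformly to [`|u|] on [[-1, 1]]. *)
Fixpoint abs_approx (k : nat) (u : R) : R :=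
  if k is k'.+1 then abs_approx k' u + (u ^+ 2 - abs_approx k' u ^+ 2) / 2
  else 0.

(** With v = |u|, one iteration multiplies the error v - q by 1 - (v + q) / 2, which lies between 0
    and 1 - v / 2 as long as 0 <= q <= v <= 1. *)
Lemma abs_approx_geometric (u : R) k : `|u| <= 1 ->
  0 <= abs_approx k u <= `|u| /\
  `|u| - abs_approx k u <= `|u| * (1 - `|u| / 2) ^+ k.
Proof.
set v := `|u| => v1; have v0 : 0 <= v by exact: normr_ge0.
have uv : u ^+ 2 = v ^+ 2 by rewrite real_normK ?num_real.
elim: k => [|k] /=; first by rewrite expr0 subr0 mulr1 !lexx v0.
rewrite uv; set q := abs_approx k u => -[/andP[q0 qv] IH].
have E : v - (q + (v ^+ 2 - q ^+ 2) / 2) = (v - q) * (1 - (v + q) / 2) by field.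
have F : (v - q) * (1 - (v + q) / 2) <= (v - q) * (1 - v / 2).
  by rewrite ler_wpM2l; lra.
have G : 0 <= (v - q) * (1 - (v + q) / 2) by apply: mulr_ge0; lra.
have K : (v - q) * (1 - v / 2) <= v * (1 - v / 2) ^+ k * (1 - v / 2).
  by rewrite ler_wpM2r//; lra.
split; last by rewrite E exprSr mulrA; exact: le_trans K.
apply/andP; split; last lra.
by rewrite addr_ge0// divr_ge0// subr_ge0 ler_sqr.
Qed.

(** A Bernoulli-type bound (1 - y)^j (1 + j y) <= 1, combined with y (k + 1) <= 1 + k y. With y =
    |u| / 2 it makes the geometric error bound uniform in [u], although the ratio tends to 1 as [u]
    tends to 0. *)
Lemma geometric_decay (y : R) k : 0 <= y <= 1 -> y * (1 - y) ^+ k * k.+1%:R <= 1.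
Proof.
move=> /andP[y0 y1].
have B j : (1 - y) ^+ j * (1 + j%:R * y) <= 1.
  elim: j => [|j IH]; first by rewrite expr0 mul0r addr0 mulr1.
  apply: le_trans IH; rewrite exprSr -mulrA ler_wpM2l ?exprn_ge0 ?subr_ge0//.
  have : 0 <= j%:R * y * y by rewrite !mulr_ge0.
  by rewrite -natr1; nra.
apply: le_trans (B k); rewrite mulrAC mulrC ler_wpM2l ?exprn_ge0 ?subr_ge0//.
by rewrite -natr1; lra.
Qed.

Lemma abs_approx_error (u : R) k : `|u| <= 1 ->
  `| `|u| - abs_approx k u| <= 2 * k.+1%:R^-1.
Proof.
move=> u1; have [/andP[q0 qu] H] := abs_approx_geometric k u1.
rewrite ger0_norm ?subr_ge0// (le_trans H)// ler_pdivlMr//.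
have := @geometric_decay (`|u| / 2) k; have := normr_ge0 u.
move=> v0 B; have {}B : `|u| / 2 * (1 - `|u| / 2) ^+ k * k.+1%:R <= 1.
  by apply: B; lra.
lra.
Qed.

End abs_approximation.

(** * Closure of almost periodic functions under absolute values and maxima *)

Section almost_periodic_lattice.
Context {R : realType} {n : nat}.
Implicit Types (f g : ('I_n -> R) -> R) (x : 'I_n -> R).

Lemma ap_abs_approx f k : almost_periodic f ->
  almost_periodic (fun x => abs_approx k (f x)).
Proof.
move=> af; elim: k => [|k IH] /=; first exact: ap_cst.
apply: ap_add => //; apply: ap_ext (ap_scale 2^-1
  (ap_add (ap_mul af af) (ap_scale (-1) (ap_mul IH IH)))) => x.
by rewrite !expr2; ring.
Qed.

Lemma ap_abs f : almost_periodic f -> almost_periodic (fun x => `|f x|).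
Proof.
move=> af; have [M fM] := ap_bounded af.
(* Dividing by a positive bound brings the values of [f] into [-1, 1], where [abs_approx] converges
   uniformly. *)
pose N := `|M| + 1; have N0 : 0 < N by rewrite ltr_pwDr.
apply: (@ap_ext _ _ (fun x => N * `|N^-1 * f x|)).
  by move=> x; rewrite normrM gtr0_norm ?invr_gt0// mulVKf// gt_eqF.
apply: ap_scale; apply: ap_ulim => e e0.
(* After k iterations the error is at most 2 / (k + 1), which dictates this number of them. *)
exists (fun x => abs_approx (Num.trunc (2 / e)) (N^-1 * f x)).
  exact/ap_abs_approx/ap_scale.
move=> x; apply: le_trans (abs_approx_error _ _) _.
  rewrite normrM gtr0_norm ?invr_gt0// mulrC ler_pdivrMr// mul1r.
  by rewrite (le_trans (fM x))// (le_trans (ler_norm _))// lerDl.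
rewrite ler_pdivrMr// mulrC -ler_pdivrMr//.
exact/ltW/truncnS_gt.
Qed.

Lemma ap_max f g : almost_periodic f -> almost_periodic g ->
  almost_periodic (fun x => Num.max (f x) (g x)).
Proof.
move=> af ag; have ad := ap_abs (ap_add af (ap_scale (-1) ag)).
apply: ap_ext (ap_scale 2^-1 (ap_add (ap_add af ag) ad)) => x.
by rewrite maxr_absE mulN1r mulrC.
Qed.

Lemma ap_bigmax (I : Type) (s : seq I) (F : I -> ('I_n -> R) -> R) :
  (forall i, almost_periodic (F i)) ->
  almost_periodic (fun x => \big[Num.max/0]_(i <- s) F i x).
Proof.
move=> aF; elim: s => [|i s IH].
  by apply: ap_ext (ap_cst 0) => x; rewrite big_nil.
by apply: ap_ext (ap_max (aF i) IH) => x; rewrite big_cons.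
Qed.

End almost_periodic_lattice.

(** * Comparison of the sine with the identity *)

Section sine_bounds.
Context {R : realType}.

Lemma sin_mean_value (y : R) : 0 <= y ->
  exists2 c, 0 <= c <= y & sin y = cos c * y.
Proof.
move=> y0; have [|c] := @MVT_segment R sin cos 0 y y0.
  by apply: continuous_subspaceT => x; exact: continuous_sin.
by rewrite in_itv/= sin0 !subr0 => cy ->; exists c.
Qed.

Lemma normr_sin_le (y : R) : `|sin y| <= `|y|.
Proof.
wlog y0 : y / 0 <= y.
  by move=> H; have [/H//|/ltW y0] := leP 0 y; rewrite -normrN -sinN -(normrN y) H// oppr_ge0.
have [c _ ->] := sin_mean_value y0.
by rewrite normrM ler_piMl// cos_max.
Qed.

(** For y >= 0, sin y = y cos c with 0 <= c <= y, and cos c = 1 - 2 sin^2 (c / 2) >= 1 - y^2 / 2.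
    The error is cubic, so it still vanishes in the limit of k |sin (x / k)|. *)
Lemma normr_sin_ge (y : R) : `|y| - `|y| ^+ 3 / 2 <= `|sin y|.
Proof.
wlog y0 : y / 0 <= y.
  by move=> H; have [/H//|/ltW y0] := leP 0 y;
    rewrite -(normrN (sin y)) -sinN -(normrN y) H// oppr_ge0.
rewrite (ger0_norm y0); have [c /andP[c0 cy] sE] := sin_mean_value y0.
apply: le_trans (ler_norm _); rewrite sE.
have -> : cos c = 1 - 2 * sin (c / 2) ^+ 2.
  rewrite {1}(_ : c = (c / 2) *+ 2); last by rewrite -mulr_natr; field.
  by rewrite cos_mulr2n cos2sin2 -mulr_natr; ring.
have : sin (c / 2) ^+ 2 <= (y / 2) ^+ 2.
  rewrite -(@real_normK _ (sin _)) ?num_real// ler_sqr ?nnegrE ?divr_ge0//.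
  by rewrite (le_trans (normr_sin_le _))// ger0_norm ?divr_ge0// ler_pM2r.
move: (sin _ ^+ 2) => s s2.
have : s * y <= (y / 2) ^+ 2 * y by rewrite ler_wpM2r.
rewrite !exprS expr0; lra.
Qed.

End sine_bounds.

Lemma measurable_bigmax {R : realType} {d} {T : measurableType d} (I : Type)
    (s : seq I) (Q : pred I) (F : I -> T -> R) :
  (forall i, measurable_fun setT (F i)) ->
  measurable_fun setT (fun w => \big[Num.max/0]_(i <- s | Q i) F i w).
Proof.
move=> mF; elim: s => [|i s IH].
  by under eq_fun do rewrite big_nil; exact: measurable_cst.
under eq_fun do rewrite big_cons.
by case: (Q i) => //; exact: measurable_maxr.
Qed.

(** * Expectations determined by the laws of linear combinations *)

Section same_law.
Context {R : realType} {d} {Omega : measurableType d} (P : probability Omega R).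

Lemma bounded_measurable_integrable (f : Omega -> R) (M : R) :
  measurable_fun setT f -> (forall w, `|f w| <= M) ->
  P.-integrable setT (EFin \o f).
Proof.
move=> mf fM; apply: measurable_bounded_integrable => //.
  by rewrite (le_lt_trans (probability_le1 P measurableT))// ltry.
by exists M; split; [exact: num_real|move=> x /ltW Mx w _; exact: le_trans (fM w) Mx].
Qed.

(** Both sides are the integral of [g] against the common pushforward measure. *)
Lemma same_law_integral (S S' : Omega -> R) (g : R -> R) (M : R) :
  measurable_fun setT S -> measurable_fun setT S' ->
  (forall B, measurable B -> P (S @^-1` B) = P (S' @^-1` B)) ->
  measurable_fun setT g -> (forall x, `|g x| <= M) ->
  (\int[P]_w (g (S w))%:E = \int[P]_w (g (S' w))%:E)%E.
Proof.
move=> mS mS' SS' mg gM.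
pose mS_pack : {mfun Omega >-> R} :=
  HB.pack S (isMeasurableFun.Build _ _ _ _ _ mS).
pose mS'_pack : {mfun Omega >-> R} :=
  HB.pack S' (isMeasurableFun.Build _ _ _ _ _ mS').
have ig (T : Omega -> R) : measurable_fun setT T ->
    P.-integrable (T @^-1` setT) ((EFin \o g) \o T).
  move=> mT; rewrite preimage_setT.
  apply: (@bounded_measurable_integrable (g \o T) M); last by move=> w; exact: gM.
  exact: measurableT_comp.
have mEg : measurable_fun setT (EFin \o g) by exact/measurable_EFinP.
have := integral_pushforward mS mEg (ig _ mS) measurableT.
rewrite preimage_setT /= => <-.
have := integral_pushforward mS' mEg (ig _ mS') measurableT.
rewrite preimage_setT /= => <-.
apply: (@eq_measure_integral _ _ _ _ (pushforward P mS'_pack) (pushforward P mS_pack)).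
by move=> A mA _; exact: SS'.
Qed.

Section vectors.
Context {n : nat} (X Y : 'I_n -> Omega -> R).
Hypothesis mX : forall i, measurable_fun setT (X i).
Hypothesis mY : forall i, measurable_fun setT (Y i).
Hypothesis XY : forall (a : 'I_n -> R) (B : set R), measurable B ->
  P ((fun w => \sum_(i < n) a i * X i w) @^-1` B) =
  P ((fun w => \sum_(i < n) a i * Y i w) @^-1` B).

(** Only the cosine case uses the equality of one-dimensional laws; linearity and uniform limits
    propagate it. Measurability is carried along because these later cases rely on it. *)
Lemma ap_same_expectation f : almost_periodic f ->
  [/\ measurable_fun setT (fun w => f (X^~ w)),
      measurable_fun setT (fun w => f (Y^~ w)) &
      \int[P]_w f (X^~ w) = \int[P]_w f (Y^~ w)].
Proof.
have ml (Z : 'I_n -> Omega -> R) (a : 'I_n -> R) :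
    (forall i, measurable_fun setT (Z i)) ->
    measurable_fun setT (fun w => \sum_(i < n) a i * Z i w).
  by move=> mZ; apply: measurable_sum => i; exact: measurable_funM.
have ib (Z : 'I_n -> Omega -> R) h : almost_periodic h ->
    measurable_fun setT (fun w => h (Z^~ w)) ->
    P.-integrable setT (EFin \o fun w => h (Z^~ w)).
  by move=> /ap_bounded[M hM] mh; exact: bounded_measurable_integrable mh _.
elim=> {f} [a b|f g af [fX fY fXY] ag [gX gY gXY]|c f af [fX fY fXY]
           |f_ f af IH ff].
- have mc : measurable_fun setT (fun x : R => cos (x + b)).
    apply: continuous_measurable_fun => x.
    apply: continuous_comp; last exact: continuous_cos.
    by apply: cvgD; [exact: cvg_id|exact: cvg_cst].
  split; [exact: measurableT_comp mc (ml _ _ mX)|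
          exact: measurableT_comp mc (ml _ _ mY)|].
  rewrite /Rintegral; congr fine.
  apply: (@same_law_integral _ _ (fun x => cos (x + b)) 1) => //.
  + exact: ml.
  + exact: ml.
  + exact: XY.
  + by move=> x; exact: cos_max.
- split; [exact: measurable_funD|exact: measurable_funD|].
  by rewrite !RintegralD//; [rewrite fXY gXY|apply: ib..].
- split; [exact: measurable_funM|exact: measurable_funM|].
  by rewrite !RintegralZl//; [rewrite fXY|apply: ib..].
- have cvf x : f_ k x @[k --> \oo] --> f x.
    apply/cvgrPdist_le => e e0.
    near=> k; rewrite (le_trans (ff k x))// ltW//; near: k.
    exact: near_infty_natSinv_lt (PosNum e0).
  have mfX : measurable_fun setT (fun w => f (X^~ w)).
    apply: (@measurable_fun_cvg _ _ _ _ (fun k w => f_ k (X^~ w))).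
      by move=> k; case: (IH k).
    by move=> w _; exact: cvf.
  have mfY : measurable_fun setT (fun w => f (Y^~ w)).
    apply: (@measurable_fun_cvg _ _ _ _ (fun k w => f_ k (Y^~ w))).
      by move=> k; case: (IH k).
    by move=> w _; exact: cvf.
  split => //.
  have aff : almost_periodic f by exact: ap_lim ff.
  (* Since [P] has total mass 1, a uniform error bounds the error in expectation. *)
  have close (Z : 'I_n -> Omega -> R) k :
      measurable_fun setT (fun w => f (Z^~ w)) ->
      measurable_fun setT (fun w => f_ k (Z^~ w)) ->
      `|\int[P]_w f (Z^~ w) - \int[P]_w f_ k (Z^~ w)| <= k.+1%:R^-1.
    move=> mf mfk; rewrite -RintegralB//; [|exact: ib..].
    have mB : measurable_fun setT (fun w => f (Z^~ w) - f_ k (Z^~ w)).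
      exact: measurable_funB.
    have iB := bounded_measurable_integrable mB (fun w => ff k (Z^~ w)).
    apply: le_trans (le_normr_Rintegral measurableT iB) _.
    apply: (@le_trans _ _ (\int[P]_w k.+1%:R^-1)).
      apply: le_Rintegral => //.
        apply: (@bounded_measurable_integrable _ k.+1%:R^-1).
          exact: measurableT_comp mB.
        by move=> w; rewrite normr_id.
      by apply: (@bounded_measurable_integrable _ `|k.+1%:R^-1|) => //.
    rewrite Rintegral_cst// (_ : fine _ = 1) ?mulr1//.
    exact: (congr1 fine (probability_setT P)).
  apply/eqP; rewrite -subr_eq0 -normr_le0; apply/ler_addgt0Pr => e e0.
  have [k ke] : exists k : nat, k.+1%:R^-1 <= e / 2.
    exists (Num.trunc (e / 2)^-1); rewrite -[leRHS]invrK lef_pV2 ?posrE ?invr_gt0 ?divr_gt0//.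
    exact/ltW/truncnS_gt.
  have [mfkX mfkY fk] := IH k.
  rewrite add0r (splitr e) (le_trans (ler_distD (\int[P]_w f_ k (X^~ w)) _ _))//.
  rewrite lerD ?(le_trans (close _ _ mfX mfkX))//.
  by rewrite fk distrC (le_trans (close _ _ mfY mfkY)).
Unshelve. all: by end_near.
Qed.

(** Fatou's lemma on the side of [X], equality of the expectations of [g k], then domination of
    [g k] by the maximum on the side of [Y]. All integrals are extended reals. *)
Lemma same_law_bigmax_le :
  (\int[P]_w (\big[Num.max/0]_(i < n) `|X i w|)%:E <=
   \int[P]_w (\big[Num.max/0]_(i < n) `|Y i w|)%:E)%E.
Proof.
pose g (k : nat) (x : 'I_n -> R) :=
  \big[Num.max/0]_(i < n) (k.+1%:R * `|sin (k.+1%:R^-1 * x i)|).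
have ag k : almost_periodic (g k).
  by apply: ap_bigmax => i; apply: ap_scale; apply: ap_abs; exact: ap_sin_coord.
have g0 k x : 0 <= g k x by exact: bigmax_ge_id.
have gmax k x : g k x <= \big[Num.max/0]_(i < n) `|x i|.
  apply: bigmax_le; first exact: bigmax_ge_id.
  move=> i _; apply: le_trans (le_bigmax _ (fun i => `|x i|) i).
  rewrite mulrC -ler_pdivlMr// (le_trans (normr_sin_le _))// normrM.
  by rewrite gtr0_norm ?invr_gt0// mulrC.
have gcvg x : g k x @[k --> \oo] --> \big[Num.max/0]_(i < n) `|x i|.
  (* By [normr_sin_ge] coordinate i loses at most |x_i|^3 / (2 (k + 1)^2); the sum of the cubes
     bounds all these losses at once by C / (k + 1). *)
  pose C := \sum_(i < n) `|x i| ^+ 3.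
  have C0 : 0 <= C by apply: sumr_ge0 => i _; exact: exprn_ge0.
  apply: (@squeeze_cvgr _ _ _ _
    (fun k => \big[Num.max/0]_(i < n) `|x i| - C * harmonic k)
    (fun=> \big[Num.max/0]_(i < n) `|x i|)); last exact: cvg_cst.
    apply: nearW => k; rewrite gmax andbT lerBlDr.
    have h0 : 0 <= C * harmonic k :> R by rewrite mulr_ge0// harmonic_ge0.
    apply: bigmax_le => [|i _]; first by rewrite addr_ge0.
    apply: (@le_trans _ _ (k.+1%:R * `|sin (k.+1%:R^-1 * x i)| + C * harmonic k)).
      have := normr_sin_ge (k.+1%:R^-1 * x i); rewrite normrM.
      rewrite gtr0_norm ?invr_gt0// /harmonic /=.
      have : `|x i| ^+ 3 <= C.
        by rewrite /C (bigD1 i)//= lerDl; apply: sumr_ge0 => j _; exact: exprn_ge0.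
      have := normr_ge0 (x i); set m := `|x i|; set t := k.+1%:R.
      move: `|sin _| => s m0 mC.
      have t1 : 1 <= t :> R by rewrite /t ler1n.
      have t0 : 0 < t by lra.
      move=> H.
      have {}H : m - m ^+ 3 / t ^+ 2 / 2 <= t * s.
        have -> : m - m ^+ 3 / t ^+ 2 / 2 = t * (t^-1 * m - (t^-1 * m) ^+ 3 / 2).
          by field; rewrite gt_eqF.
        by rewrite ler_pM2l.
      have : m ^+ 3 / t ^+ 2 / 2 <= C / t.
        rewrite -mulrA ler_pM ?exprn_ge0// ?mulr_ge0 ?invr_ge0 ?exprn_ge0 ?(ltW t0)//.
        rewrite -invfM lef_pV2 ?posrE ?mulr_gt0 ?exprn_gt0// expr2; nra.
      by move=> H2; rewrite -lerBlDr (le_trans _ H)// lerB.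
    by rewrite lerD2r; exact: (le_bigmax _ (fun i => k.+1%:R * `|sin (k.+1%:R^-1 * x i)|) i).
  rewrite -[X in _ --> X]subr0 -[X in _ - X](mulr0 C).
  apply: cvgB; first exact: cvg_cst.
  by apply: cvgM; [exact: cvg_cst|exact: cvg_harmonic].
have mg k : [/\ measurable_fun setT (fun w => g k (X^~ w)),
      measurable_fun setT (fun w => g k (Y^~ w)) &
      \int[P]_w g k (X^~ w) = \int[P]_w g k (Y^~ w)].
  exact: ap_same_expectation.
have eg k : (\int[P]_w (g k (X^~ w))%:E = \int[P]_w (g k (Y^~ w))%:E)%E.
  have [M hM] := ap_bounded (ag k); have [mgX mgY gXY] := mg k.
  have iX := bounded_measurable_integrable mgX (fun w => hM _).
  have iY := bounded_measurable_integrable mgY (fun w => hM _).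
  have fX := integrable_fin_num measurableT iX.
  have fY := integrable_fin_num measurableT iY.
  by rewrite -(fineK fX) -(fineK fY); congr EFin; exact: gXY.
have -> : (\int[P]_w (\big[Num.max/0]_(i < n) `|X i w|)%:E =
    \int[P]_w limn_einf (fun k => (g k (X^~ w))%:E))%E.
  apply: eq_integral => w _; apply/esym.
  apply: (cvg_limn_einf_sup _).1.
  by apply: cvg_EFin; [exact: nearW|exact: gcvg].
apply: le_trans (fatou _ _ _ _) _ => //.
- by move=> k; apply/measurable_EFinP; case: (mg k).
- by move=> k w _; rewrite lee_fin.
(* The lower limit is the limit of the tail infima, and the k-th of these is at most the k-th
   term. *)
rewrite limn_einf_lim; apply: lime_le; first exact: is_cvg_einfs.
apply: nearW => k; apply: (@le_trans _ _ (\int[P]_w (g k (X^~ w))%:E)%E).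
  by apply: ereal_inf_lbound; exists k => /=.
rewrite eg; apply: ge0_le_integral => //.
- by move=> w _; rewrite lee_fin.
- by apply/measurable_EFinP; case: (mg k).
- apply/measurable_EFinP.
  by apply: measurable_bigmax => i; exact: measurableT_comp.
- by move=> w _; rewrite lee_fin gmax.
Qed.

End vectors.
End same_law.

(** * The second moment of a centered normal law *)

Section normal_second_moment.
Context {R : realType}.
Notation mu := (@lebesgue_measure R).

(** The Radon-Nikodym derivative of [normal_prob] agrees almost everywhere with [normal_pdf], as
    both have the same integral over every measurable set. *)
Lemma ge0_integral_normal_prob (s : R) (f : R -> \bar R) :
  (forall x, 0 <= f x)%E -> measurable_fun setT f ->
  (\int[normal_prob 0 s]_x f x = \int[mu]_x (f x * (normal_pdf 0 s x)%:E))%E.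
Proof.
move=> f0 mf; have dom := normal_prob_dominates 0 s.
rewrite -(Radon_Nikodym_SigmaFinite.change_of_variables dom)//.
have mpdf : measurable_fun setT (fun x : R => (normal_pdf 0 s x)%:E).
  by apply/measurable_EFinP; exact: measurable_normal_pdf.
have ir := Radon_Nikodym_SigmaFinite.f_integrable dom.
apply: ae_eq_integral => //.
- by apply: emeasurable_funM => //; exact: (measurable_int mu ir).
- exact: emeasurable_funM.
- apply: ae_eqe_mul2l; apply: integral_ae_eq => //.
  by move=> E _ mE; rewrite -Radon_Nikodym_SigmaFinite.f_integral.
Qed.

(** The right side is exp y times the density of deviation [s], where y = (1 - t^-2) x^2 / (2 s^2);
    then 1 + y <= exp y. *)
Lemma normal_pdf_scale (s t x : R) : 0 < s -> 1 < t ->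
  (1 - t ^- 2) / (s ^+ 2 *+ 2) * (x ^+ 2 * normal_pdf 0 s x) + normal_pdf 0 s x
    <= t * normal_pdf 0 (t * s) x.
Proof.
move=> s0 t1; have t0 : 0 < t by lra.
rewrite !normal_pdfE ?mulf_neq0 ?gt_eqF//.
have -> : normal_peak (t * s) = t^-1 * normal_peak s.
  rewrite /normal_peak exprMn -mulrA -mulrnAr sqrtrM ?sqr_ge0//.
  by rewrite sqrtr_sqr gtr0_norm// invfM.
rewrite -[t^-1 * _ * _]mulrA mulVKf ?gt_eqF// /normal_fun subr0.
set y := (1 - t ^- 2) / (s ^+ 2 *+ 2) * x ^+ 2.
have -> : - x ^+ 2 / ((t * s) ^+ 2 *+ 2) = - x ^+ 2 / (s ^+ 2 *+ 2) + y.
  rewrite /y exprMn -mulrnAr invfM; move: (s ^+ 2 *+ 2)^-1 (t ^- 2) => a b.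
  by ring.
rewrite expRD [leRHS]mulrA mulrA -/y; set p := normal_peak s * expR _.
have p0 : 0 <= p by rewrite mulr_ge0 ?expR_ge0 ?normal_peak_ge0.
by have := expR_ge1Dx y; nra.
Qed.

(* Integrating the previous lemma bounds the second moment by
   [s ^ 2 * 2 t ^ 2 / (t + 1)] for every [t > 1]; then let [t] tend to [1]. *)
Lemma normal_second_moment_le (s : R) : 0 < s ->
  (\int[normal_prob 0 s]_x (x ^+ 2)%:E <= (s ^+ 2)%:E)%E.
Proof.
move=> s0; rewrite ge0_integral_normal_prob//; last 2 first.
- by move=> x; rewrite lee_fin sqr_ge0.
- by apply/measurable_EFinP; exact: exprn_measurable.
under eq_integral do rewrite -EFinM.
set I := (\int[mu]_x _)%E.
have I0 : (0 <= I)%E.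
  by apply: integral_ge0 => x _; rewrite lee_fin mulr_ge0 ?sqr_ge0 ?normal_pdf_ge0.
have mpdf r : measurable_fun setT (fun x : R => (normal_pdf 0 r x)%:E).
  by apply/measurable_EFinP; exact: measurable_normal_pdf.
have mx2 : measurable_fun setT (fun x : R => (x ^+ 2 * normal_pdf 0 s x)%:E).
  apply/measurable_EFinP; apply: measurable_funM; first exact: exprn_measurable.
  exact: measurable_normal_pdf.
(* Integrate [normal_pdf_scale]; both densities have total mass 1. *)
have key t : 1 < t -> (((1 - t ^- 2) / (s ^+ 2 *+ 2))%:E * I + 1 <= t%:E)%E.
  move=> t1; have t0 : 0 < t by lra.
  have c0 : 0 <= (1 - t ^- 2) / (s ^+ 2 *+ 2).
    rewrite divr_ge0// ?mulrn_wge0 ?sqr_ge0// subr_ge0 invf_le1 ?exprn_gt0//.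
    by rewrite expr_ge1 ?ltW.
  rewrite -[X in (_ + X)%E](integral_normal_pdf 0 s) -ge0_integralZl//; last first.
  - by move=> x _; rewrite lee_fin mulr_ge0 ?sqr_ge0 ?normal_pdf_ge0.
  rewrite -ge0_integralD//; last 4 first.
  - by move=> x _; rewrite -EFinM lee_fin mulr_ge0// mulr_ge0 ?sqr_ge0 ?normal_pdf_ge0.
  - exact: measurable_funeM.
  - by move=> x _; rewrite lee_fin normal_pdf_ge0.
  - exact: mpdf.
  apply: (@le_trans _ _ (\int[mu]_x (t%:E * (normal_pdf 0 (t * s) x)%:E)))%E;
    last first.
    rewrite ge0_integralZl//; last 3 first.
    - exact: mpdf.
    - by move=> x _; rewrite lee_fin normal_pdf_ge0.
    - by rewrite lee_fin ltW.
    by rewrite integral_normal_pdf mule1.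
  apply: ge0_le_integral => //.
  - move=> x _; rewrite -EFinM -EFinD lee_fin addr_ge0 ?normal_pdf_ge0//.
    by rewrite mulr_ge0// mulr_ge0 ?sqr_ge0 ?normal_pdf_ge0.
  - apply: emeasurable_funD; last exact: mpdf.
    exact: measurable_funeM.
  - by apply: measurable_funeM; exact: mpdf.
  - by move=> x _; rewrite -!EFinM -EFinD lee_fin normal_pdf_scale.
apply/lee_addgt0Pr => e e0.
(* With t = 1 + h the moment is at most 2 s^2 (1 + h)^2 / (2 + h) <= s^2 (1 + h)^2 <= s^2 (1 + 3 h),
   the last step by h <= 1. The other bound on h keeps the excess 3 h s^2 below e. *)
pose h := Num.min 1 (e / (3 * s ^+ 2)).
have s20 : 0 < s ^+ 2 by exact: exprn_gt0.
have h0 : 0 < h by rewrite lt_min ltr01 divr_gt0// mulr_gt0.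
have h1 : h <= 1 by rewrite ge_min lexx.
have he : h * (3 * s ^+ 2) <= e.
  by rewrite -ler_pdivlMr ?mulr_gt0// ge_min lexx orbT.
have t1 : 1 < 1 + h by lra.
have := key _ t1; case: (I) I0 => [r| |]; last by [].
- rewrite lee_fin => r0; rewrite -EFinM -EFinD -EFinD !lee_fin => H.
  have tn : 1 + h != 0 by rewrite gt_eqF//; lra.
  have E : (1 - (1 + h) ^- 2) / (s ^+ 2 *+ 2) =
      h * (2 + h) / (2 * (1 + h) ^+ 2 * s ^+ 2).
    by rewrite -mulr_natr; field; rewrite tn gt_eqF.
  rewrite E in H; have {}H : (2 + h) / (2 * (1 + h) ^+ 2 * s ^+ 2) * r <= 1.
    have : h * ((2 + h) / (2 * (1 + h) ^+ 2 * s ^+ 2) * r) <= h * 1.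
      by rewrite mulr1 !mulrA; lra.
    by rewrite ler_pM2l.
  have D0 : 0 < 2 * (1 + h) ^+ 2 * s ^+ 2.
    have ? : 0 < (1 + h) ^+ 2 by apply: exprn_gt0; lra.
    by rewrite mulr_gt0// mulr_gt0.
  have {}H : (2 + h) * r <= 2 * (1 + h) ^+ 2 * s ^+ 2.
    by move: H; rewrite mulrAC ler_pdivrMr// mul1r.
  have H2 : r <= (1 + h) ^+ 2 * s ^+ 2 by nra.
  apply: (le_trans H2); rewrite -[leRHS]addr0; nra.
(* An infinite second moment would make the left side of [key] infinite. *)
- move=> _; rewrite gt0_muley ?addye// lte_fin divr_gt0 ?pmulrn_lgt0//.
  rewrite subr_gt0 invf_lt1 ?exprn_gt0//; last by lra.
  by rewrite exprn_egt1.
Qed.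

End normal_second_moment.

(** * Centered Gaussian variables, degenerate ones included *)

Section centered_gaussian.
Context {R : realType} {d} {Omega : measurableType d} (P : probability Omega R).
Implicit Types X Y : Omega -> R.

Lemma centered_gaussian0_ae X : centered_gaussian P X 0 ->
  {ae P, forall w, X w = 0}.
Proof.
move=> [mX]; rewrite eqxx => PX.
have mX0 : measurable [set w | X w = 0].
  by rewrite -[X in measurable X]setTI; exact: (mX measurableT [set 0]).
exists (~` [set w | X w = 0]); split => //; first exact: measurableC.
by rewrite probability_setC// PX subee.
Qed.

Lemma centered_gaussian_same_law X Y v :
  centered_gaussian P X v -> centered_gaussian P Y v ->
  forall B, measurable B -> P (X @^-1` B) = P (Y @^-1` B).
Proof.
have [->|v0] := eqVneq v 0; last first.
  by move=> [_ +] [_ +]; rewrite (negbTE v0) => PX PY B mB; rewrite PX// PY.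
(* A variable of variance 0 vanishes almost surely, so its law is the point mass at 0. *)
suff H Z : centered_gaussian P Z 0 -> forall B, measurable B ->
    P (Z @^-1` B) = (\1_B 0)%:E by move=> gX gY B mB; rewrite !H.
move=> gZ B mB; have [mZ _] := gZ.
have mZB : measurable (Z @^-1` B).
  by rewrite -[X in measurable X]setTI; exact: mZ.
rewrite -(setIT (Z @^-1` B)) -integral_indic//.
rewrite (ae_eq_integral (fun=> (\1_B 0)%:E))//.
- by rewrite integral_cst//= probability_setT mule1.
- exact/measurable_EFinP/measurable_indic.
- have := centered_gaussian0_ae gZ; apply: filterS => w Zw _.
  rewrite !indicE (_ : (w \in Z @^-1` B) = (0 \in B))//.
  by rewrite -Zw.
Qed.

Lemma centered_gaussian_second_moment X v : 0 <= v ->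
  centered_gaussian P X v -> (\int[P]_w (X w ^+ 2)%:E <= v%:E)%E.
Proof.
move=> v_ge0 gX; have [mX lawX] := gX.
have [v0|v0] := eqVneq v 0.
  rewrite v0 in gX *.
  rewrite (ae_eq_integral (cst 0%E))//; first by rewrite integral_cst// mul0e.
  - exact/measurable_EFinP/measurable_funX.
  - have := centered_gaussian0_ae gX; apply: filterS => w Xw _.
    by rewrite Xw expr0n.
rewrite (negbTE v0) in lawX; have v_gt0 : 0 < v by rewrite lt_def v0.
have s0 : 0 < Num.sqrt v by rewrite sqrtr_gt0.
rewrite -[v in (_ <= v%:E)%E]sqr_sqrtr//.
apply: le_trans (normal_second_moment_le s0).
(* [X] is retyped so that its pushforward and [normal_prob] are measures on the same measurable
   type. *)
have mX' : measurable_fun setT (X : Omega -> measurableTypeR R).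
  by move=> mT A mA; exact: (mX mT A mA).
pose mX_pack : {mfun Omega >-> measurableTypeR R} :=
  HB.pack (X : Omega -> measurableTypeR R)
    (isMeasurableFun.Build _ _ _ _ (X : Omega -> measurableTypeR R) mX').
have mx2 : measurable_fun setT (fun x : measurableTypeR R => (x ^+ 2)%:E).
  by apply/measurable_EFinP; exact: exprn_measurable.
have := @ge0_integral_pushforward _ _ _ _ _ _ mX' P setT _ measurableT mx2.
rewrite preimage_setT /= => <-; last by move=> x _; rewrite lee_fin sqr_ge0.
rewrite (@eq_measure_integral _ (measurableTypeR R) _ _ (normal_prob 0 (Num.sqrt v))
  (pushforward P mX_pack))// => A mA _.
exact: lawX.
Qed.

End centered_gaussian.

(** * Orthogonal projections, reflections and Gram-Schmidt *)

Section inner_product_space.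
Context {R : realType} {H : normedModType R} (ip : H -> H -> R).
Hypothesis ipP : inner_product ip.
Implicit Types (x y z : H) (e s : seq H).

Lemma ipC x y : ip x y = ip y x. Proof. exact: ipP.1. Qed.

Lemma ip_sqr_norm x : ip x x = `|x| ^+ 2. Proof. exact: ipP.2.2. Qed.

Lemma ipPl a x y z : ip (a *: x + y) z = a * ip x z + ip y z.
Proof. exact: ipP.2.1. Qed.

Lemma ip0l z : ip 0 z = 0.
Proof. by have := ipPl (-1) 0 0 z; rewrite scaler0 addr0 mulN1r addNr. Qed.

Lemma ipZl a x z : ip (a *: x) z = a * ip x z.
Proof. by rewrite -[a *: x]addr0 ipPl ip0l addr0. Qed.

Lemma ipDl x y z : ip (x + y) z = ip x z + ip y z.
Proof. by have := ipPl 1 x y z; rewrite scale1r mul1r. Qed.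

Lemma ipBl x y z : ip (x - y) z = ip x z - ip y z.
Proof. by rewrite -[- y]scaleN1r ipDl ipZl mulN1r. Qed.

Lemma ip_suml (I : Type) (r : seq I) (F : I -> H) z :
  ip (\sum_(i <- r) F i) z = \sum_(i <- r) ip (F i) z.
Proof. exact: (big_morph (ip^~ z) (fun x y => ipDl x y z) (ip0l z)). Qed.

Lemma ipZr a x z : ip z (a *: x) = a * ip z x.
Proof. by rewrite ipC ipZl ipC. Qed.

Lemma ipBr x y z : ip z (x - y) = ip z x - ip z y.
Proof. by rewrite !(ipC z) ipBl. Qed.

Lemma ip_sumr (I : Type) (r : seq I) (F : I -> H) z :
  ip z (\sum_(i <- r) F i) = \sum_(i <- r) ip z (F i).
Proof. by rewrite ipC ip_suml; apply: eq_bigr => i _; exact: ipC. Qed.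

Definition orthonormal_seq e :=
  uniq e /\ {in e &, forall x y, ip x y = (x == y)%:R}.

Definition oproj e x : H := \sum_(y <- e) ip x y *: y.

Lemma oprojP e a x y : oproj e (a *: x + y) = a *: oproj e x + oproj e y.
Proof.
rewrite /oproj scaler_sumr -big_split /=; apply: eq_bigr => z _.
by rewrite ipPl scalerDl scalerA.
Qed.

Lemma oproj0 e : oproj e 0 = 0.
Proof. by rewrite /oproj big1// => y _; rewrite ip0l scale0r. Qed.

Lemma oprojB e x y : oproj e (x - y) = oproj e x - oproj e y.
Proof. by rewrite addrC -scaleN1r oprojP scaleN1r addrC. Qed.

Lemma ip_oproj e x y : orthonormal_seq e -> y \in e -> ip (oproj e x) y = ip x y.
Proof.
move=> [ue oe] ye; rewrite /oproj ip_suml (bigD1_seq y)//= ipZl (oe y y)// eqxx mulr1.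
rewrite big_seq_cond big1 ?addr0// => z /andP[ze /negbTE zy].
by rewrite ipZl (oe z y)// zy mulr0.
Qed.

(** The residual [x - oproj e x] is orthogonal to the span of [e], which contains [oproj e y]. *)
Lemma ip_oproj2 e x y : orthonormal_seq e ->
  ip (oproj e x) (oproj e y) = ip x (oproj e y).
Proof.
move=> oe; rewrite {2 3}/oproj !ip_sumr big_seq [RHS]big_seq.
by apply: eq_bigr => z ze; rewrite !ipZr ip_oproj.
Qed.

(** In the expansion, two cross terms with factor -2 cancel the term with factor 4, the projection
    being self-adjoint and idempotent. *)
Lemma ip_reflection e x y : orthonormal_seq e ->
  ip (x - 2 *: oproj e x) (y - 2 *: oproj e y) = ip x y.
Proof.
move=> oe; have E : ip (oproj e x) y = ip x (oproj e y).
  by rewrite -(ip_oproj2 x y oe) ipC -(ip_oproj2 y x oe) ipC.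
by rewrite !ipBl !ipBr !ipZl !ipZr ip_oproj2// E; ring.
Qed.

(** The difference of the two sides is the squared norm of the residual. *)
Lemma bessel e x : orthonormal_seq e ->
  \sum_(y <- e) ip x y ^+ 2 <= `|x| ^+ 2.
Proof.
move=> oe; have -> : \sum_(y <- e) ip x y ^+ 2 = ip x (oproj e x).
  by rewrite /oproj ip_sumr; apply: eq_bigr => y _; rewrite ipZr expr2.
rewrite -subr_ge0; suff -> : `|x| ^+ 2 - ip x (oproj e x) = `|x - oproj e x| ^+ 2.
  exact: exprn_ge0.
by rewrite -!ip_sqr_norm !ipBl !ipBr ip_oproj2// (ipC (oproj e x)); ring.
Qed.

(** Each new vector contributes its normalised residual, or nothing if that residual is 0. The size
    bound is what later brings in the covering number. *)
Lemma gram_schmidt s : exists e, [/\ orthonormal_seq e, (size e <= size s)%N &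
  {in s, forall x, oproj e x = x}].
Proof.
elim: s => [|x s [e [oe es pe]]]; first by exists [::].
pose r := x - oproj e x; have xE : x = r + oproj e x by rewrite subrK.
have [r0|r0] := eqVneq r 0.
  exists e; split => //; first exact: leqW.
  move=> z; rewrite inE => /orP[/eqP ->|/pe//].
  by rewrite {2}xE r0 add0r.
have nr : `|r| != 0 by rewrite normr_eq0.
pose u := `|r|^-1 *: r.
have ury : {in e, forall y, ip u y = 0}.
  by move=> y ye; rewrite ipZl ipBl ip_oproj// subrr mulr0.
have uu : ip u u = 1.
  by rewrite ipZl ipZr ip_sqr_norm; field.
have u_oproj z : ip (oproj e z) u = 0.
  rewrite /oproj ip_suml big_seq big1// => y ye.
  by rewrite ipZl (ipC y) ury// mulr0.
have ue : u \notin e.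
  apply/negP => ue; have := ury _ ue; rewrite uu => /eqP.
  by rewrite oner_eq0.
exists (u :: e); split => //.
- split; first by rewrite /= ue oe.1.
  move=> y z; rewrite !inE => /orP[/eqP ->|ye] /orP[/eqP ->|ze].
  + by rewrite uu eqxx.
  + by rewrite ury//; case: eqP ze ue => // -> ->.
  + by rewrite ipC ury//; case: eqP ye ue => // -> ->.
  + exact: oe.2.
- move=> z; rewrite /oproj big_cons -/(oproj e z) inE => /orP[/eqP ->|zs].
    rewrite {1}xE ipDl u_oproj addr0 {1}/u ipZr ip_sqr_norm {1}/u scalerA.
    have -> : `|r|^-1 * `|r| ^+ 2 * `|r|^-1 = 1 by field.
    by rewrite scale1r -xE.
  by rewrite -{1}(pe _ zs) u_oproj scale0r add0r pe.
Qed.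

End inner_product_space.

(** * Almost sure linearity of the process and its invariance under isometries *)

Section isonormal.
Context {R : realType} {H : normedModType R} (ip : H -> H -> R).
Context {d} {Omega : measurableType d} (P : probability Omega R).
Context (W : H -> Omega -> R).
Hypothesis ipP : inner_product ip.
Hypothesis WP : isonormal ip P W.

Lemma isonormal_gaussian h : centered_gaussian P (W h) (`|h| ^+ 2).
Proof.
have := WP (fun _ : 'I_1 => 1) (fun=> h).
rewrite !big_ord1 !mul1r ip_sqr_norm//.
by under eq_fun do rewrite big_ord1 mul1r.
Qed.

Lemma isonormal_measurable h : measurable_fun setT (W h).
Proof. exact: (isonormal_gaussian h).1. Qed.

Lemma isonormal_second_moment h :
  (\int[P]_w (W h w ^+ 2)%:E <= (`|h| ^+ 2)%:E)%E.
Proof.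
by apply: centered_gaussian_second_moment; [rewrite exprn_ge0|
  exact: isonormal_gaussian].
Qed.

(** The variance of the combination is the squared norm of the corresponding vector, hence 0. *)
Lemma isonormal_kernel n (a : 'I_n -> R) (h : 'I_n -> H) :
  \sum_(i < n) a i *: h i = 0 ->
  {ae P, forall w, \sum_(i < n) a i * W (h i) w = 0}.
Proof.
move=> ah0; apply: centered_gaussian0_ae.
suff v0 : \sum_(i < n) \sum_(j < n) a i * a j * ip (h i) (h j) = 0.
  by have := WP a h; rewrite v0.
transitivity (ip (\sum_(i < n) a i *: h i) (\sum_(i < n) a i *: h i)).
  rewrite (ip_suml ipP); apply: eq_bigr => i _.
  rewrite (ip_sumr ipP); apply: eq_bigr => j _.
  by rewrite (ipZl ipP) (ipZr ipP) mulrA.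
by rewrite ah0 (ip0l ipP).
Qed.

(** This is [isonormal_kernel] for the relation (a x + y) - a x - y = 0. The null set depends on
    [a], [x] and [y], so only finitely many such relations are combined at a time. *)
Lemma isonormal_linear a x y :
  {ae P, forall w, W (a *: x + y) w = a * W x w + W y w}.
Proof.
pose c (i : 'I_3) : R := nth 0 [:: 1; - a; -1] i.
pose h (i : 'I_3) : H := nth 0 [:: a *: x + y; x; y] i.
have : {ae P, forall w, \sum_(i < 3) c i * W (h i) w = 0}.
  apply: isonormal_kernel; rewrite !big_ord_recl big_ord0 /c /h /=.
  by rewrite scale1r scaleNr scaleN1r addr0 -opprD subrr.
apply: filterS => w; rewrite !big_ord_recl big_ord0 /c /h /= => E.
lra.
Qed.

Lemma isonormal_sum (I : Type) (s : seq I) (a : I -> R) (h : I -> H) :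
  {ae P, forall w, W (\sum_(i <- s) a i *: h i) w = \sum_(i <- s) a i * W (h i) w}.
Proof.
elim: s => [|i s IH].
  (* The empty sum needs W 0 = 0 almost surely, which comes from 0 = -1 * 0 + 0. *)
  have := isonormal_linear (-1) 0 0; apply: filterS => w.
  by rewrite !big_nil scaler0 addr0 mulN1r addNr.
have := isonormal_linear (a i) (h i) (\sum_(i <- s) a i *: h i).
by apply: filterS2 IH => w IH; rewrite !big_cons => ->; rewrite IH.
Qed.

(** Linear combinations before and after [U] are centered Gaussian with the same variance, so
    [same_law_bigmax_le] applies once the list is indexed by positions. *)
Lemma isonormal_isometry_bigmax (U : H -> H) (I : Type) (s : seq I) (h : I -> H) :
  (forall x y, ip (U x) (U y) = ip x y) ->
  (\int[P]_w (\big[Num.max/0]_(i <- s) `|W (U (h i)) w|)%:E <=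
   \int[P]_w (\big[Num.max/0]_(i <- s) `|W (h i) w|)%:E)%E.
Proof.
move=> UP.
under eq_integral do rewrite big_tnth.
under [leRHS]eq_integral do rewrite big_tnth.
pose g (i : 'I_(size s)) := h (tnth (in_tuple s) i).
apply: (@same_law_bigmax_le _ _ _ P _ (fun i => W (U (g i))) (fun i => W (g i))).
- by move=> i; exact: isonormal_measurable.
- by move=> i; exact: isonormal_measurable.
move=> a; apply: centered_gaussian_same_law (WP _ (fun i => g i)).
have := WP a (fun i => U (g i)).
by under eq_bigr do under eq_bigr do rewrite UP.
Qed.

(* [x - oproj e x] is the midpoint of [x] and of its reflection
   [x - 2 *: oproj e x], and [W] composed with the reflection has the law of
   [W]. *)
Lemma isonormal_residual_le e (I : Type) (s : seq I) (h : I -> H) :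
  orthonormal_seq ip e ->
  (\int[P]_w (\big[Num.max/0]_(i <- s) `|W (h i - oproj ip e (h i)) w|)%:E <=
   \int[P]_w (\big[Num.max/0]_(i <- s) `|W (h i) w|)%:E)%E.
Proof.
move=> oe; pose U x := x - 2 *: oproj ip e x.
have UP x y : ip (U x) (U y) = ip x y by exact: (ip_reflection ipP).
pose M (g : I -> H) w := \big[Num.max/0]_(i <- s) `|W (g i) w|.
have M0 g w : 0 <= M g w by exact: bigmax_ge_id.
have mM g : measurable_fun setT (fun w => (M g w)%:E).
  apply/measurable_EFinP/measurable_bigmax => i.
  exact/measurableT_comp/isonormal_measurable.
(* A maximum of averages is at most the average of the maxima; induction on the list collects the
   null sets. *)
have mid : {ae P, forall w,
    M (fun i => h i - oproj ip e (h i)) w <=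
    2^-1 * M h w + 2^-1 * M (U \o h) w}.
  rewrite /M; elim: (s) => [|i r IH].
    by apply: aeW => w; rewrite !big_nil mulr0 addr0.
  have : {ae P, forall w, W (h i - oproj ip e (h i)) w =
      2^-1 * W (h i) w + 2^-1 * W (U (h i)) w}.
    have := isonormal_sum [:: h i; U (h i)] (fun=> 2^-1) id.
    apply: filterS => w; rewrite !big_cons !big_nil !addr0 => <-.
    congr (W _ w); rewrite /U scalerBr scalerA mulVf// scale1r addrA.
    by rewrite -scalerDl -{1}[h i]scale1r; congr (_ *: _ - _); field.
  apply: filterS2 IH => w IH E; rewrite !big_cons E ge_max; apply/andP; split.
    rewrite (le_trans (ler_normD _ _))// !normrM gtr0_norm ?invr_gt0//.
    by rewrite lerD// ler_wpM2l ?invr_ge0// le_max lexx.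
  by rewrite (le_trans IH)// lerD// ler_wpM2l ?invr_ge0// le_max lexx orbT.
apply: (@le_trans _ _ (\int[P]_w (2^-1%:E * (M h w)%:E + 2^-1%:E * (M (U \o h) w)%:E)))%E.
  apply: ae_ge0_le_integral => //.
  - by move=> w _; rewrite lee_fin; exact: bigmax_ge_id.
  - exact: mM (fun i => h i - oproj ip e (h i)).
  - by move=> w _; rewrite -!EFinM -EFinD lee_fin addr_ge0// mulr_ge0 ?invr_ge0.
  - by apply: emeasurable_funD; exact: measurable_funeM.
  - by apply: filterS mid => w Mw _; rewrite -!EFinM -EFinD lee_fin.
have h0 : (0 <= 2^-1%:E :> \bar R)%E by rewrite lee_fin invr_ge0.
rewrite ge0_integralD//; last 4 first.
- by move=> w _; rewrite mule_ge0 ?lee_fin.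
- exact: measurable_funeM.
- by move=> w _; rewrite mule_ge0 ?lee_fin.
- exact: measurable_funeM.
rewrite !ge0_integralZl//; [|by move=> w _; rewrite lee_fin..].
apply: (@le_trans _ _ (2^-1%:E * \int[P]_w (M h w)%:E + 2^-1%:E * \int[P]_w (M h w)%:E)%E).
  by rewrite leeD2l// lee_wpmul2l//; exact: isonormal_isometry_bigmax.
by rewrite -ge0_muleDl// -EFinD -[X in (X + X)%R]mul1r -splitr mul1e.
Qed.

End isonormal.

(** * Deterministic and almost sure tools for the final estimate *)

Lemma linear_form_bound {R : realType} (I : Type) (s : seq I) (c z : I -> R)
    (r delta : R) :
  0 < r -> 0 < delta -> \sum_(i <- s) c i ^+ 2 <= delta ^+ 2 ->
  `|\sum_(i <- s) c i * z i| <=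
    delta / 2 * (r + r^-1 * \sum_(i <- s) z i ^+ 2).
Proof.
(* Weighted inequality |a b| <= (l a^2 + b^2 / l) / 2. This form of Cauchy-Schwarz has no square
   root of a random sum, so its mean needs second moments only; if the [z i] have total second
   moment at most r^2, this mean is at most delta r. *)
move=> r0 d0 cd; set l := r / delta; have l0 : 0 < l by rewrite divr_gt0.
have H : `|\sum_(i <- s) c i * z i| <=
    2^-1 * (l * \sum_(i <- s) c i ^+ 2 + l^-1 * \sum_(i <- s) z i ^+ 2).
  rewrite !mulr_sumr -big_split /= mulr_sumr.
  apply: (le_trans (ler_norm_sum _ _ _)); apply: ler_sum => i _.
  rewrite normrM -(real_normK (num_real (c i))) -(real_normK (num_real (z i))).
  move: `|c i| `|z i| => a b.
  have -> : 2^-1 * (l * a ^+ 2 + l^-1 * b ^+ 2) =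
      a * b + 2^-1 * l * (a - l^-1 * b) ^+ 2 by field; rewrite gt_eqF.
  by rewrite lerDl mulr_ge0 ?sqr_ge0// mulr_ge0 ?invr_ge0 ?ltW.
apply: (le_trans H).
have -> : delta / 2 * (r + r^-1 * \sum_(i <- s) z i ^+ 2) =
    2^-1 * (l * delta ^+ 2 + l^-1 * \sum_(i <- s) z i ^+ 2).
  by rewrite /l; field; rewrite !gt_eqF.
by rewrite ler_pM2l ?invr_gt0// lerD2r ler_pM2l.
Qed.

Lemma ae_seq {R : realType} {d} {T : measurableType d} (P : probability T R)
    (I : eqType) (s : seq I) (Q : I -> T -> Prop) :
  (forall i, i \in s -> {ae P, forall w, Q i w}) ->
  {ae P, forall w, forall i, i \in s -> Q i w}.
Proof.
elim: s => [_|i s IH Qs]; first by apply: aeW.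
have Qi : {ae P, forall w, Q i w} by apply: Qs; rewrite mem_head.
have /IH : forall j, j \in s -> {ae P, forall w, Q j w}.
  by move=> j js; apply: Qs; rewrite inE js orbT.
apply: filterS2 Qi => w Qi Qw j; rewrite inE => /orP[/eqP ->//|].
exact: Qw.
Qed.

Lemma convex_sum_bound {R : realType} (I : eqType) (s : seq I) (a b : I -> R) (M : R) :
  (forall i, i \in s -> 0 <= a i) -> \sum_(i <- s) a i = 1 ->
  (forall i, i \in s -> `|b i| <= M) -> `|\sum_(i <- s) a i * b i| <= M.
Proof.
move=> a0 a1 bM; rewrite -[M]mul1r -a1 mulr_suml.
apply: (le_trans (ler_norm_sum _ _ _)).
rewrite big_seq [leRHS]big_seq; apply: ler_sum => i si.
by rewrite normrM (ger0_norm (a0 _ si)) ler_wpM2l ?a0 ?bM.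
Qed.

(** Lists of weighted points keep the number of terms out of the type, so one can be chosen for each
    point of the hull. *)
Lemma conv_hull_seq {R : realType} {H : normedModType R} (A : set H) x :
  conv_hull A x -> exists L : seq (R * H),
  [/\ forall p, p \in L -> 0 <= p.1 /\ A p.2, \sum_(p <- L) p.1 = 1 &
      x = \sum_(p <- L) p.1 *: p.2].
Proof.
move=> [n [a [f [a0 [a1 [Af ->]]]]]].
exists [seq (a i, f i) | i <- index_enum 'I_n]; split.
- by move=> p /mapP[i _ ->]; split; [exact: a0|exact: Af].
- by rewrite big_map.
- by rewrite big_map.
Qed.

(** * Moduli of continuity, covering numbers and the estimate for one net *)

Section modulus.
Context {R : realType} {H : normedModType R} (ip : H -> H -> R).
Context {d} {Omega : measurableType d} (P : probability Omega R).
Context (W : H -> Omega -> R).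

Lemma pair_sup_ge0 (S : {fset H}) delta w : 0 <= pair_sup W S delta w.
Proof. exact: bigmax_ge_id. Qed.

Lemma pair_sup_le (S : {fset H}) delta w (M : R) : 0 <= M ->
  (forall f g, f \in S -> g \in S -> `|f - g| <= delta -> `|W f w - W g w| <= M) ->
  pair_sup W S delta w <= M.
Proof.
move=> M0 SM; rewrite /pair_sup big_seq; apply: bigmax_le => // f fS.
by rewrite big_seq_cond; apply: bigmax_le => // g /andP[gS fg]; exact: SM.
Qed.

Lemma le_pair_sup (S : {fset H}) delta w f g : f \in S -> g \in S ->
  `|f - g| <= delta -> `|W f w - W g w| <= pair_sup W S delta w.
Proof.
move=> fS gS fg; apply: (@bigmax_sup_seq _ _ _ _ _ f) => //.
exact: (@bigmax_sup_seq _ _ _ _ _ g).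
Qed.

Lemma modulus_ge0 (A : set H) delta : (0 <= modulus P W A delta)%E.
Proof.
apply: (@le_trans _ _ (\int[P]_w (pair_sup W fset0 delta w)%:E)%E).
  by apply: integral_ge0 => w _; rewrite lee_fin pair_sup_ge0.
by apply: ereal_sup_ubound; exists fset0; split.
Qed.

Lemma modulus0 (A : set H) : (modulus P W A 0 <= 0)%E.
Proof.
apply: ge_ereal_sup => _ [S [_ ->]]; rewrite integral0_eq// => w _.
congr EFin; apply/eqP; rewrite eq_le pair_sup_ge0 andbT.
apply: pair_sup_le => // f g _ _; rewrite normr_le0 subr_eq0 => /eqP ->.
by rewrite subrr normr0.
Qed.

(** Cardinals are natural numbers, so the infimum is attained as soon as a finite net exists. *)
Lemma covering_number_fin (A : set H) eps :
  covering_number A eps = +oo%E \/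
  exists S : {fset H}, [/\ forall x, x \in S -> A x,
    forall x, A x -> exists2 y, y \in S & `|x - y| <= eps &
    covering_number A eps = (#|` S|%:R)%:E].
Proof.
pose net (S : {fset H}) := (forall x, x \in S -> A x) /\
  (forall x, A x -> exists2 y, y \in S & `|x - y| <= eps).
have [|noS] := pselect (exists n : nat, `[< exists2 S, net S & #|` S| = n >]); last first.
  left; rewrite /covering_number (_ : [set z | _] = set0) ?ereal_inf0//.
  apply/seteqP; split=> [z [S [SA [SN _]]]|z []]; apply: noS.
  by exists #|` S|; apply/asboolP; exists S.
move=> exn; right; case: (ex_minnP exn) => n /asboolP[S [SA SN] <-] Smin.
exists S; split => //; apply/eqP; rewrite eq_le; apply/andP; split.
  by apply: ereal_inf_lbound; exists S.
apply: le_ereal_inf_tmp => _ [S' [SA' [SN' ->]]].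
by rewrite lee_fin ler_nat; apply: Smin; apply/asboolP; exists S'.
Qed.

Hypothesis ipP : inner_product ip.
Hypothesis WP : isonormal ip P W.

Lemma measurable_pair_sup (S : {fset H}) delta :
  measurable_fun setT (pair_sup W S delta).
Proof.
apply: measurable_bigmax => f; apply: measurable_bigmax => g.
by apply: measurableT_comp => //; apply: measurable_funB;
  exact: (isonormal_measurable ipP WP).
Qed.

Lemma modulus_conv_hull_le (F : set H) (N : {fset H}) (eps delta : R) :
  0 < delta -> (forall x, x \in N -> F x) ->
  (forall x, F x -> exists2 y, y \in N & `|x - y| <= eps) ->
  (modulus P W (conv_hull F) delta <=
   2%:E * modulus P W F eps + (delta * Num.sqrt #|` N|%:R)%:E)%E.
Proof.
move=> d0 NF Ncov; apply: ge_ereal_sup => _ [S [SF ->]].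
have [e [oe eN pe]] := gram_schmidt ipP N.
(* The nearby net point [pi x] takes the junk value 0 off [F]; likewise the decomposition [L x] is
   empty off the hull. *)
have /choice[pi piP] : forall x, exists y, F x -> y \in N /\ `|x - y| <= eps.
  move=> x; have [Fx|nFx] := pselect (F x); last by exists 0.
  by have [y yN xy] := Ncov _ Fx; exists y.
have /choice[L LP] : forall x, exists L : seq (R * H), conv_hull F x ->
    [/\ forall p, p \in L -> 0 <= p.1 /\ F p.2, \sum_(p <- L) p.1 = 1 &
      x = \sum_(p <- L) p.1 *: p.2].
  move=> x; have [Fx|nFx] := pselect (conv_hull F x); last by exists [::].
  by have [l lP] := conv_hull_seq Fx; exists l.
(* All points of [F] that occur in the chosen convex combinations: a finite list, as the modulus
   demands. *)
pose T := [seq p.2 | p <- flatten [seq L f | f <- S]].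
have LT f p : f \in S -> p \in L f -> p.2 \in T.
  move=> fS pL; apply: map_f; apply/flattenP; exists (L f) => //; exact: map_f.
have TF u : u \in T -> F u.
  move=> /mapP[p /flattenP[l /mapP[f fS ->] pL] ->].
  by have [/(_ _ pL)[]] := LP _ (SF _ fS).
pose k u := u - pi u.
pose M w := \big[Num.max/0]_(u <- T) `|W (k u - oproj ip e (k u)) w|.
pose Q w := \sum_(y <- e) W y w ^+ 2.
pose r := Num.sqrt (size e)%:R : R.
have M0 w : 0 <= M w by exact: bigmax_ge_id.
have Q0 w : 0 <= Q w by apply: sumr_ge0 => y _; exact: sqr_ge0.
have r_ge0 : 0 <= r by exact: sqrtr_ge0.
have mW h := isonormal_measurable ipP WP h.
have dr_ge0 w : 0 <= delta / 2 * (r + r^-1 * Q w).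
  by rewrite mulr_ge0 ?divr_ge0 ?addr_ge0 ?mulr_ge0 ?invr_ge0// ltW.
have mM : measurable_fun setT M.
  by apply: measurable_bigmax => u; apply: measurableT_comp => //; exact: mW.
have mQ : measurable_fun setT Q.
  by apply: measurable_sum => y; exact/measurable_funX/mW.
have mEM : measurable_fun setT (fun w => (M w)%:E) by exact/measurable_EFinP.
have mEQ : measurable_fun setT (fun w => (Q w)%:E) by exact/measurable_EFinP.
have mE2M : measurable_fun setT (fun w => (2 * M w)%:E).
  by apply/measurable_EFinP; exact: measurable_funM.
have mEr : measurable_fun setT (fun w => (delta / 2 * (r + r^-1 * Q w))%:E).
  apply/measurable_EFinP; apply: measurable_funM => //.
  by apply: measurable_funD => //; exact: measurable_funM.
have split_ae : {ae P, forall w, forall f, f \in S ->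
    W f w = W (f - oproj ip e f) w + \sum_(y <- e) ip f y * W y w}.
  apply: ae_seq => f _.
  have := isonormal_sum ipP WP e (ip f) id.
  have := isonormal_linear ipP WP 1 (f - oproj ip e f) (oproj ip e f).
  by apply: filterS2 => w; rewrite scale1r subrK mul1r => -> <-.
(* The residual map is linear and kills every [pi u], which lies in [N]; so each [u] may be replaced
   by [k u]. *)
have resid_ae : {ae P, forall w, forall f, f \in S ->
    W (f - oproj ip e f) w =
    \sum_(p <- L f) p.1 * W (k p.2 - oproj ip e (k p.2)) w}.
  apply: ae_seq => f fS; have [LF _ fE] := LP _ (SF _ fS).
  have := isonormal_sum ipP WP (L f) fst (fun p => k p.2 - oproj ip e (k p.2)).
  apply: filterS => w <-; congr (W _ w).
  have -> : oproj ip e f = \sum_(p <- L f) p.1 *: oproj ip e p.2.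
    rewrite {1}fE; elim: (L f) => [|p l IH]; first by rewrite !big_nil (oproj0 ipP).
    by rewrite !big_cons (oprojP ipP) IH.
  rewrite {1}fE -sumrB; rewrite big_seq [RHS]big_seq; apply: eq_bigr => p pL.
  have [piN _] := piP _ (LF _ pL).2.
  by rewrite -scalerBr (oprojB ipP) (pe _ piN) opprB addrA subrK.
have pair_ae : {ae P, forall w, setT w ->
    ((pair_sup W S delta w)%:E <=
     (2 * M w)%:E + (delta / 2 * (r + r^-1 * Q w))%:E)%E}.
  apply: filterS2 split_ae resid_ae => w Wsplit Wres _.
  have Wr f : f \in S -> `|W (f - oproj ip e f) w| <= M w.
    move=> fS; rewrite Wres//; have [LF L1 _] := LP _ (SF _ fS).
    apply: convex_sum_bound => // p pL; first exact: (LF _ pL).1.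
    by apply: (@bigmax_sup_seq _ _ _ _ _ p.2) => //; exact: LT pL.
  rewrite -EFinD lee_fin; apply: pair_sup_le.
    by rewrite addr_ge0 ?dr_ge0// mulr_ge0.
  move=> f g fS gS fg; rewrite (Wsplit f)// (Wsplit g)//.
  have B : `|\sum_(y <- e) ip (f - g) y * W y w| <= delta / 2 * (r + r^-1 * Q w).
    (* An empty basis gives r = 0, outside the scope of [linear_form_bound], but the sum is then
       empty. *)
    have [e0|e0] := eqVneq e [::].
      rewrite /Q e0 !big_nil normr0 mulr0 addr0.
      by rewrite mulr_ge0// divr_ge0// ltW.
    apply: linear_form_bound => //.
      by rewrite sqrtr_gt0 ltr0n lt0n size_eq0.
    by rewrite (le_trans (bessel ipP _ oe))// ler_sqr ?nnegrE// ltW.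
  have -> : W (f - oproj ip e f) w + \sum_(y <- e) ip f y * W y w -
      (W (g - oproj ip e g) w + \sum_(y <- e) ip g y * W y w) =
      (W (f - oproj ip e f) w - W (g - oproj ip e g) w) +
      \sum_(y <- e) ip (f - g) y * W y w.
    have -> : \sum_(y <- e) ip (f - g) y * W y w =
        \sum_(y <- e) ip f y * W y w - \sum_(y <- e) ip g y * W y w.
      by rewrite -sumrB; apply: eq_bigr => y _; rewrite (ipBl ipP) mulrBl.
    by ring.
  rewrite (le_trans (ler_normD _ _))// lerD//.
  by rewrite (le_trans (ler_normB _ _))// mulr_natl mulr2n lerD// Wr.
have MF : (\int[P]_w (M w)%:E <= modulus P W F eps)%E.
  apply: (le_trans (isonormal_residual_le ipP WP T k oe)).
  (* Both [u] and [pi u] must belong to the finite set for W (k u) to be one of its increments. *)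
  pose T' := [fset x in T ++ N]%fset.
  apply: (@le_trans _ _ (\int[P]_w (pair_sup W T' eps w)%:E)%E); last first.
    apply: ereal_sup_ubound; exists T'; split => // x.
    by rewrite !inE => /orP[/TF|/NF].
  apply: ae_ge0_le_integral => //.
  - by move=> w _; rewrite lee_fin; exact: bigmax_ge_id.
  - apply/measurable_EFinP/measurable_bigmax => u.
    by apply: measurableT_comp => //; exact: mW.
  - by move=> w _; rewrite lee_fin pair_sup_ge0.
  - exact/measurable_EFinP/measurable_pair_sup.
  have : {ae P, forall w, forall u, u \in T -> W (k u) w = W u w - W (pi u) w}.
    apply: ae_seq => u _.
    have := isonormal_linear ipP WP (-1) (pi u) u.
    by apply: filterS => w; rewrite scaleN1r mulN1r addrC => ->; rewrite addrC.
  apply: filterS => w Wk _; rewrite lee_fin big_seq.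
  apply: bigmax_le => [|u uT]; first exact: pair_sup_ge0.
  have [piN upi] := piP _ (TF _ uT).
  rewrite Wk//; apply: le_pair_sup => //.
    by rewrite !inE uT.
  by rewrite !inE piN orbT.
(* Each basis vector has norm 1, so it contributes at most 1. *)
have IQ : (\int[P]_w (Q w)%:E <= (size e)%:R%:E)%E.
  under eq_integral do rewrite -sumEFin.
  rewrite ge0_integral_sum//; last 2 first.
  - by move=> y; exact/measurable_EFinP/measurable_funX/mW.
  - by move=> y w _; rewrite lee_fin sqr_ge0.
  apply: (@le_trans _ _ (\sum_(y <- e) 1%:E)%E); last first.
    by rewrite sumEFin big_const_seq count_predT iter_addr addr0.
  rewrite big_seq [leRHS]big_seq; apply: lee_sum => y ye.
  apply: (le_trans (isonormal_second_moment ipP WP y)).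
  by rewrite -(ip_sqr_norm ipP) oe.2// eqxx.
apply: (le_trans (ae_ge0_le_integral _ _ _ _ _ pair_ae)) => //.
- by move=> w _; rewrite lee_fin pair_sup_ge0.
- exact/measurable_EFinP/measurable_pair_sup.
- by move=> w _; rewrite -EFinD lee_fin addr_ge0 ?dr_ge0// mulr_ge0.
- by apply: emeasurable_funD.
rewrite ge0_integralD//; last 2 first.
- by move=> w _; rewrite lee_fin mulr_ge0.
- by move=> w _; rewrite lee_fin dr_ge0.
apply: leeD.
  under eq_integral do rewrite EFinM.
  by rewrite ge0_integralZl// ?lee_wpmul2l// => w _; rewrite lee_fin.
under eq_integral do rewrite mulrDr mulrA EFinD (EFinM (delta / 2 / r)).
have c_ge0 : 0 <= delta / 2 / r by rewrite !divr_ge0// ltW.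
rewrite ge0_integralD//; last 3 first.
- by move=> w _; rewrite lee_fin mulr_ge0// divr_ge0// ltW.
- by move=> w _; rewrite -EFinM lee_fin mulr_ge0.
- exact: measurable_funeM.
rewrite integral_cst// [X in (_ * X)%E](probability_setT P) mule1 ge0_integralZl//; last first.
  by move=> w _; rewrite lee_fin.
apply: (@le_trans _ _ ((delta / 2 * r)%:E + (delta / 2 / r)%:E * (size e)%:R%:E)%E).
  by rewrite leeD2l// lee_wpmul2l ?lee_fin.
have er : (size e)%:R = r ^+ 2 :> R by rewrite sqr_sqrtr.
rewrite -EFinM -EFinD lee_fin er.
apply: (@le_trans _ _ (delta * r)); last first.
  by rewrite ler_pM2l// ler_sqrt// ler_nat.
(* For r > 0, (delta / 2) (r + r^2 / r) = delta r; for r = 0 both sides vanish. *)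
have [->|r0] := eqVneq r 0; first by rewrite !mulr0 expr0n mulr0 addr0.
by rewrite le_eqVlt; apply/orP; left; apply/eqP; field.
Qed.

End modulus.

(** * Passage to the infimum over all radii *)

Theorem theorem1 (R : realType) (H : completeNormedModType R)
  (ip : H -> H -> R) (d : measure_display) (Omega : measurableType d)
  (P : probability Omega R) (W : H -> Omega -> R) (F : set H) (delta : R) :
  inner_product ip -> isonormal ip P W -> 0 <= delta ->
  (modulus P W (conv_hull F) delta <=
   ereal_inf [set z | exists eps : R, (0 < eps)%R /\
      z = 2%:E * modulus P W F eps
          + delta%:E * sqrte (covering_number F eps)])%E.
Proof.
move=> ipP WP; rewrite le_eqVlt => /orP[/eqP <-|d0];
  apply: le_ereal_inf_tmp => _ [eps [_ ->]].
  (* For [delta] = 0 the left side vanishes, and on the right 0 times an infinite covering number is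
     0. *)
  apply: (le_trans (modulus0 _ _ _)).
  by rewrite mul0e adde0 mule_ge0// modulus_ge0.
have [->|[N [NF Ncov ->]]] := covering_number_fin F eps.
  (* Without a finite net the right side is infinite, since [delta] > 0 and the modulus is
     nonnegative. *)
  rewrite /= gt0_muley// addey ?leey// gt_eqF// (@lt_le_trans _ _ 0%E)//.
  by rewrite mule_ge0// modulus_ge0.
by rewrite /= -EFinM; exact: (modulus_conv_hull_le ipP WP).
Qed.
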